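(* Let $n\ge2$ be an integer, and let $s\in\Theta^n$ be any strategy profile of the $n$-player quantum volunteer's dilemma $G^{(n)}_{\mathrm{QVD}}$ for which $\$_a(s)=2-\frac1n$ for all $a\in[n]$. Then $s$ is Pareto optimal in $G^{(n)}_{\mathrm{QVD}}$.
   Context: Notation: $[n]=\{1,\ldots,n\}$; $[P]$ is the Iverson bracket, equal to $1$ if $P$ is true and $0$ otherwise. For $x\in\{0,1\}^n$, $\mathrm{wt}(x)=|\{i\in[n]:x_i=1\}|$ is the Hamming weight and $\bar x$ is the bitwise complement ($\bar x_i=1-x_i$). Deterministic volunteer's dilemma payoffs: for $x\in\{0,1\}^n$ ($x_i=1$ means player $i$ volunteers, $x_i=0$ means player $i$ abstains), $\$_i^{\mathrm{VD}}(x)=2-\frac1{\mathrm{wt}(x)}$ if $x_i=1$, and $\$_i^{\mathrm{VD}}(x)=2\,[\mathrm{wt}(x)>0]$ if $x_i=0$. Quantum volunteer's dilemma $G^{(n)}_{\mathrm{QVD}}$: the $n$-player game in which every player's strategy set is $\Theta=[0,4\pi)\times[0,2\pi)$. Strategy $(\theta_i,\phi_i)\in\Theta$ means that player $i$ applies to qubit $i$ the unitary $$U(\theta_i,\phi_i)=\begin{pmatrix}e^{\mathrm i\phi_i}\cos(\theta_i/2)&\sin(\theta_i/2)\\-\sin(\theta_i/2)&e^{-\mathrm i\phi_i}\cos(\theta_i/2)\end{pmatrix}.$$ Let $J=e^{-\frac{\mathrm i\pi}{4}Y^{\otimes n}}=\frac1{\sqrt2}(I-\mathrm iY^{\otimes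 n})$ with $Y=\begin{pmatrix}0&-\mathrm i\\\mathrm i&0\end{pmatrix}$, and let $|x\rangle$, $x\in\{0,1\}^n$, be the computational basis of $(\mathbb C^2)^{\otimes n}$. For a strategy profile $(\theta,\phi)=((\theta_1,\phi_1),\ldots,(\theta_n,\phi_n))\in\Theta^n$ and $x\in\{0,1\}^n$, the probability that exactly the players $i$ with $x_i=1$ volunteer is $$p_{\theta,\phi}(x)=\left|\langle\bar x|J^\dagger\Big(\bigotimes_{j=1}^nU(\theta_j,\phi_j)\Big)J|0\rangle^{\otimes n}\right|^2,$$ and the payoff function of player $i$ is $\$_i(\theta,\phi)=\sum_{x\in\{0,1\}^n}\$_i^{\mathrm{VD}}(x)\,p_{\theta,\phi}(x)$. For a profile $s=(\theta,\phi)$ write $\$_i(s)=\$_i(\theta,\phi)$. Pareto optimality: a profile $s\in\Theta^n$ is Pareto optimal if for every player $i\in[n]$ and every profile $t\in\Theta^n$: if $\$_i(t)>\$_i(s)$, then there exists $j\in[n]\setminus\{i\}$ such that $\$_j(t)<\$_j(s)$. *)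

(* Defs.v *)
From mathcomp Require Import all_boot all_order all_algebra.
From mathcomp Require Import spectral complex reals trigo.

Set Implicit Arguments.
Unset Strict Implicit.
Unset Printing Implicit Defensive.

Import Order.TTheory GRing.Theory Num.Theory.
Local Open Scope ring_scope.
Local Open Scope complex_scope.
Local Open Scope sesquilinear_scope.

(* Players are numbered 0, ..., n-1, and all players share one strategy set. *)
Record game (R : numDomainType) (n : nat) := Game {
  strategy : Type;
  payoff : 'I_n -> ('I_n -> strategy) -> R
}.

Definition profile (R : numDomainType) (n : nat) (G : game R n) : Type :=
  'I_n -> strategy G.

Definition pareto_optimal (R : numDomainType) (n : nat) (G : game R n)
    (s : profile G) : Prop :=
  forall (i : 'I_n) (t : profile G),
    payoff i s < payoff i t ->
    exists j : 'I_n, j != i /\ payoff j t < payoff j s.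

(* [x i = true] means that player [i] volunteers. *)
Notation bits n := {ffun 'I_n -> bool}.

Definition wt (n : nat) (x : bits n) : nat := #|[set i | x i]|.

Definition compl (n : nat) (x : bits n) : bits n := [ffun i => ~~ x i].

Definition vd_payoff (R : realType) (n : nat) (i : 'I_n) (x : bits n) : R :=
  if x i then 2 - (wt x)%:R^-1 else 2 * (0 < wt x)%N%:R.

Section Qubits.
Variables (R : realType) (n : nat).

Definition mx22 (a b c d : R[i]) : 'M[R[i]]_2 :=
  \matrix_(i, j) if i == 0 then (if j == 0 then a else b)
                 else (if j == 0 then c else d).

(* The computational basis of the n-qubit space is indexed by [bits n];
   [enum_rank] and [enum_val] translate to and from matrix indices. *)
Definition dim : nat := #|{: bits n}|.

Definition ket (x : bits n) : 'cV[R[i]]_dim := delta_mx (enum_rank x) 0.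

Definition tensor (A : 'I_n -> 'M[R[i]]_2) : 'M[R[i]]_dim :=
  \matrix_(a, b) \prod_(j < n)
    A j (inord ((enum_val a : bits n) j)) (inord ((enum_val b : bits n) j)).

Definition expi (x : R) : R[i] := cos x +i* sin x.

Definition U (theta phi : R) : 'M[R[i]]_2 :=
  mx22 (expi phi * (cos (theta / 2))%:C) (sin (theta / 2))%:C
       (- (sin (theta / 2))%:C) (expi (- phi) * (cos (theta / 2))%:C).

Definition Y : 'M[R[i]]_2 := mx22 0 (- 'i%C) 'i%C 0.

(* exp(-i pi/4 Y^(tensor n)) in closed form, as Y^(tensor n) squares to 1. *)
Definition J : 'M[R[i]]_dim :=
  ((Num.sqrt 2)^-1)%:C *: (1%:M - 'i%C *: tensor (fun=> Y)).

Definition Theta : Type :=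
  {s : R * R | (0 <= s.1 < 4 * pi) && (0 <= s.2 < 2 * pi)}.

Definition amplitude (s : 'I_n -> Theta) (x : bits n) : R[i] :=
  ((ket (compl x))^t* *m J^t* *m
     tensor (fun j => U (val (s j)).1 (val (s j)).2) *m
     J *m ket [ffun=> false]) 0 0.

Definition prob (s : 'I_n -> Theta) (x : bits n) : R :=
  ComplexField.Normc.normc (amplitude s x) ^+ 2.

Definition QVD : game R n :=
  Game (fun i (s : 'I_n -> Theta) => \sum_(x : bits n) vd_payoff R i x * prob s x).

End Qubits.

(* Main.v *)
(** Every outcome in which somebody volunteers distributes a total payoff of
    2n - 1, and the outcome without volunteers distributes 0.  Since the final
    state is the image of a basis vector under a unitary matrix, outcome
    probabilities add up to 1, so no profile has a total payoff above 2n - 1,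
    which is what a profile paying 2 - 1/n to everybody reaches. *)
Require Import Defs.
From mathcomp Require Import all_boot all_order all_algebra reals.
From mathcomp Require Import spectral complex trigo ring.
Import Order.TTheory GRing.Theory Num.Theory.
Local Open Scope ring_scope.
Local Open Scope complex_scope.
Local Open Scope sesquilinear_scope.

Section Unitarity.
Variables (R : realType) (n : nat).
Implicit Types A B : 'I_n -> 'M[R[i]]_2.

Lemma eq_tensor A B : A =1 B -> tensor A = tensor B.
Proof.
by move=> AB; apply/matrixP=> a b; rewrite !mxE; apply: eq_bigr=> j _; rewrite AB.
Qed.

(** [tensor] addresses single-qubit entries by bits, so a matrix product over one qubit has to be
    summed over [bool] too. *)
Lemma sum_ord2_bool (F : 'I_2 -> R[i]) : \sum_i F i = \sum_(b : bool) F (inord b).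
Proof.
rewrite big_bool !big_ord_recl big_ord0 addr0 addrC.
by congr (F _ + F _); apply: val_inj; rewrite /= inordK.
Qed.

Lemma mul_tensor A B : tensor A *m tensor B = tensor (fun j => A j *m B j).
Proof.
apply/matrixP=> a b; rewrite !mxE.
under [RHS]eq_bigr do rewrite mxE sum_ord2_bool.
(* Distributivity turns the product over qubits of two-term sums into one sum over all bit strings,
   which are the inner indices of the left-hand product. *)
rewrite bigA_distr_bigA (reindex (@enum_rank (bits n))); last first.
  by exists enum_val => x _; rewrite ?enum_rankK ?enum_valK.
by apply: eq_bigr => x _; rewrite !mxE enum_rankK -big_split.
Qed.

Lemma tensor1 : tensor (fun=> 1%:M) = 1%:M :> 'M[R[i]]_(Defs.dim n).
Proof.
apply/matrixP=> a b; rewrite !mxE.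
case: eqVneq => [->|ab]; first by rewrite big1 // => j _; rewrite mxE eqxx.
(* Distinct indices differ in some bit [j], and the factor at [j] is an off-diagonal entry of the
   identity. *)
have [j abj] : exists j, (enum_val a : bits n) j != (enum_val b : bits n) j.
  apply/existsP; rewrite -negb_forall; apply: contra ab => /forallP eq_ab.
  by apply/eqP/enum_val_inj/ffunP=> j; apply/eqP.
rewrite (bigD1 j) //= mxE -val_eqE /= !inordK ?ltnS ?leq_b1 //.
by case: (_ j) (_ j) abj => [] [] //; rewrite mul0r.
Qed.

Lemma adj_tensor A : (tensor A)^t* = tensor (fun j => (A j)^t*).
Proof.
apply/matrixP=> a b; rewrite !mxE rmorph_prod.
by apply: eq_bigr=> j _; rewrite !mxE.
Qed.

Lemma tensor_unitary A :
  (forall j, A j \is unitarymx) -> tensor A \is unitarymx.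
Proof.
move=> uA; apply/unitarymxP; rewrite adj_tensor mul_tensor -tensor1.
by apply: eq_tensor=> j; apply/unitarymxP.
Qed.

Lemma U_unitary (theta phi : R) : U theta phi \is unitarymx.
Proof.
apply/unitarymxP/matrixP=> i j; rewrite !mxE !big_ord_recl big_ord0 !mxE.
case: i => [[|[|//]] ?]; case: j => [[|[|//]] ?]; rewrite /= /expi ?cosN ?sinN.
all: apply/eqP; rewrite eq_complex /=; apply/andP; split; apply/eqP.
(* Only the real parts of the two diagonal entries need the Pythagorean identity, for [phi] and then
   for [theta / 2]. *)
all: first [ring | transitivity ((cos phi ^+ 2 + sin phi ^+ 2) *
  cos (theta / 2) ^+ 2 + sin (theta / 2) ^+ 2);
  [ring | by rewrite cos2Dsin2 mul1r cos2Dsin2]].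
Qed.

Lemma Y_adj : (Y R)^t* = Y R.
Proof.
apply/matrixP=> i j; rewrite !mxE.
by case: i => [[|[|//]] ?]; case: j => [[|[|//]] ?];
  apply/eqP; rewrite eq_complex /= ?oppr0 ?opprK !eqxx.
Qed.

Lemma Y_sqr : Y R *m Y R = 1%:M.
Proof.
apply/matrixP=> i j; rewrite !mxE !big_ord_recl big_ord0 !mxE.
case: i => [[|[|//]] ?]; case: j => [[|[|//]] ?].
all: apply/eqP; rewrite eq_complex /=; apply/andP; split; apply/eqP.
all: ring.
Qed.

(** As [T] is Hermitian with square 1, (1 - iT)(1 + iT) = 1 + T^2 = 2, and the squared prefactor 1/2
    cancels this. *)
Lemma J_unitary : J R n \is unitarymx.
Proof.
rewrite /J; set T := tensor _; set c : R := _^-1.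
have T_adj : T^t* = T by rewrite adj_tensor; apply: eq_tensor => _; exact: Y_adj.
have T_sqr : T *m T = 1%:M.
  by rewrite mul_tensor -tensor1; apply: eq_tensor => _; exact: Y_sqr.
clearbody T.
have c_sqr : c%:C * c%:C * (1 + 1) = 1 :> R[i].
  have -> : 1 + 1 = (2 : R)%:C by rewrite rmorphD.
  by rewrite -!rmorphM -expr2 exprVn sqr_sqrtr ?ler0n // mulVf ?pnatr_eq0.
have i_sqr : 'i%C * 'i%C = -1 :> R[i] by rewrite -expr2 sqr_i.
have c_conj : Num.conj c%:C = c%:C :> R[i] by exact: conjc_real.
have i_conj : Num.conj 'i%C = - 'i%C :> R[i].
  by apply/eqP; rewrite eq_complex /= oppr0 !eqxx.
have T_adjE a b : Num.conj (T b a) = T a b by rewrite -[in RHS]T_adj !mxE.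
have J_adj : (c%:C *: (1%:M - 'i%C *: T))^t* = c%:C *: (1%:M + 'i%C *: T).
  apply/matrixP=> a b; rewrite !mxE !(rmorphM, rmorphB, rmorph_nat) /=.
  by rewrite T_adjE eq_sym c_conj i_conj mulNr opprK.
apply/unitarymxP; rewrite J_adj -scalemxAl -scalemxAr scalerA.
rewrite mulmxBl !mulmxDr mulmx1 mul1mx -!scalemxAl -!scalemxAr T_sqr.
rewrite mulmx1 scalerA i_sqr scaleN1r opprD opprK addrA addrK.
by rewrite -mulr2n -scaler_nat scalerA c_sqr scale1r.
Qed.

(** The amplitudes are the entries of one column of the unitary [M], and such a column has norm
    1. *)
Lemma sum_prob (s : 'I_n -> Theta R) : \sum_x prob s x = 1.
Proof.
pose M := (J R n)^t* *m tensor (fun j => U (val (s j)).1 (val (s j)).2) *m J R n.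
have uM : M \is unitarymx.
  rewrite !mul_unitarymx ?trmxC_unitary ?J_unitary //.
  by apply: tensor_unitary => j; exact: U_unitary.
pose k : 'I_(Defs.dim n) := enum_rank [ffun=> false].
have amplE x : amplitude s x = M (enum_rank (compl x)) k.
  rewrite /amplitude /ket -/k trmx_delta map_delta_mx -colE mxE.
  by rewrite -!mulmxA -rowE mxE mulmxA.
clearbody M.
have probE x : (prob s x)%:C =
    M^t* k (enum_rank (compl x)) * M (enum_rank (compl x)) k.
  by rewrite /prob rmorphXn /= !mxE -amplE mulrC -sqr_normc.
apply: (@complexI R); rewrite rmorph_sum (eq_bigr _ (fun x _ => probE x)) /=.
transitivity ((M^t* *m M) k k); last first.
  (* [unitarymxP] gives orthonormal rows; since [M] is square, its columns are orthonormal as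
     well. *)
  by rewrite (mulmx1C (unitarymxP uM)) mxE eqxx.
rewrite mxE [RHS](reindex (fun x => enum_rank (compl x))) //=.
(* Complementing is an involution, so the outcomes run through every row exactly once. *)
exists (fun a => compl (enum_val a)) => a _; rewrite ?enum_rankK.
  by apply/ffunP=> j; rewrite !ffunE negbK.
rewrite -[RHS]enum_valK; congr enum_rank.
by apply/ffunP=> j; rewrite !ffunE negbK.
Qed.
End Unitarity.

Lemma ltr_sum_at (R : numDomainType) (I : finType) (f g : I -> R) (i : I) :
  f i < g i -> (forall j, j != i -> f j <= g j) -> \sum_j f j < \sum_j g j.
Proof.
move=> fg_i fg; rewrite (bigD1 i) // [ltRHS](bigD1 i) //=.
by apply: ltr_leD => //; apply: ler_sum.
Qed.

(** If w > 0 players volunteer, they share w(2 - 1/w) = 2w - 1 and the others get 2(n - w). *)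
Lemma sum_vd_payoff (R : realType) (n : nat) (x : bits n) :
  \sum_i vd_payoff R i x = (2 * n%:R - 1) * (0 < wt x)%N%:R.
Proof.
rewrite (bigID x) /=.
rewrite (eq_bigr (fun=> 2 - (wt x)%:R^-1)); last first.
  by move=> i; rewrite /vd_payoff => ->.
rewrite [X in _ + X](eq_bigr (fun=> 2 * (0 < wt x)%N%:R)); last first.
  by move=> i; rewrite /vd_payoff => /negPf ->.
rewrite !sumr_const.
have -> : #|[pred i | x i]| = wt x by rewrite /wt cardsE.
have -> : n%:R = (wt x)%:R + #|[pred i | ~~ x i]|%:R :> R.
  by rewrite /wt cardsE -natrD cardC card_ord.
(* Without volunteers the term with [0^-1] is taken zero times, and both sides are 0. *)
case: (posnP (wt x)) => [->|w_gt0]; first by rewrite mulr0 mulr0n mul0rn addr0 mulr0.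
rewrite !mulr1 -[_ *+ wt x]mulr_natr -[2 *+ _]mulr_natr.
by rewrite mulrBl mulVf ?pnatr_eq0 -?lt0n // mulrDr addrAC.
Qed.

Lemma sum_payoff_le (R : realType) (n : nat) (t : profile (QVD R n)) :
  (0 < n)%N -> \sum_i payoff i t <= 2 * n%:R - 1.
Proof.
move=> n_gt0; rewrite /= exchange_big /=.
rewrite -[leRHS]mulr1 -[X in _ <= _ * X](sum_prob R n t) mulr_sumr.
apply: ler_sum => x _.
rewrite -mulr_suml sum_vd_payoff ler_wpM2r ?sqr_ge0 //.
(* Bounding the indicator by 1 requires 2n - 1 >= 0; for n = 0 the claim would read 0 <= -1. *)
rewrite ler_piMr ?lern1 ?leq_b1 //.
by rewrite -natrM subr_ge0 ler1n muln_gt0.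
Qed.

Theorem theorem11 (R : realType) (n : nat) (hn : (2 <= n)%N)
    (s : profile (QVD R n))
    (hs : forall a : 'I_n, payoff a s = 2 - n%:R^-1) :
  pareto_optimal s.
Proof.
move=> i t lt_i.
have sum_s : \sum_a payoff a s = 2 * n%:R - 1.
  rewrite (eq_bigr _ (fun a _ => hs a)) sumr_const card_ord -[LHS]mulr_natr mulrBl.
  by rewrite mulVf // pnatr_eq0 -lt0n; apply: leq_trans hn.
have le_ts : \sum_a payoff a t <= \sum_a payoff a s.
  by rewrite [leRHS]sum_s; apply: sum_payoff_le; apply: leq_trans hn.
have [/existsP [j /andP[]] |] :=
  boolP [exists j, (j != i) && (payoff j t < payoff j s)]; first by exists j.
(* If nobody other than [i] loses, the gain of [i] lifts the total strictly above that of [s],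
   contradicting [le_ts]. *)
rewrite negb_exists => /forallP not_lt.
have le_st j : j != i -> payoff j s <= payoff j t.
  by move=> ji; have := not_lt j; rewrite ji -leNgt.
have lt_st : \sum_a payoff a s < \sum_a payoff a t by apply: ltr_sum_at lt_i le_st.
by have := lt_le_trans lt_st le_ts; rewrite ltxx.
Qed.
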